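(* Let $N, n_x$ be positive integers and let $A_i\in\mathbb{R}^{n_x\times n_x}$, $b_i\in\mathbb{R}^{n_x}$, $i\in\{1,\dots,N\}$, be the data of a switched affine system. For a given $x^*\in\mathcal{X}_F$, consider $p>1$ distinct solutions $\lambda^{(1)},\dots,\lambda^{(p)}\in\mathbb{R}^N$ of $$M(x^* )\lambda=0,\quad \lambda\ge 0,\quad \mathbf{1}'\lambda=1,$$ and let $L=[\lambda^{(1)},\dots,\lambda^{(p)}]\in\mathbb{R}^{N\times p}$ be the matrix with these columns. Then the set $$\mathbb{P}(x^* )=\{\lambda\in\mathbb{R}^{N} : \lambda=L\theta,\ \lambda\ge 0,\ \theta\in\Theta_p\}$$ is a polytope of dimension $d=\mathrm{rank}(L)$, $\mathbb{P}(x^* )\subseteq\Lambda$, and every $\lambda^*\in\mathbb{P}(x^* )$ is also associated with $x^*\in\mathcal{X}_F$.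
   Context: The switched affine system is $\dot x(t)=A_{\sigma(t)}x(t)+b_{\sigma(t)}$ with state $x(t)\in\mathbb{R}^{n_x}$ and switching signal $\sigma(t)\in\{1,\dots,N\}$. The unit simplex is $\Lambda=\{\lambda\in\mathbb{R}^N : \mathbf{1}'\lambda=1,\ \lambda\ge 0\}$, and $\Theta_p=\{\theta\in\mathbb{R}^p : \mathbf{1}'\theta=1\}$ (entries of $\theta$ may be negative), where $\mathbf{1}$ is the vector of ones of suitable size, $'$ denotes transpose, and vector inequalities are componentwise. For $\lambda\in\Lambda$, $A(\lambda)=\sum_{i=1}^N\lambda_iA_i$ and $b(\lambda)=\sum_{i=1}^N\lambda_ib_i$. The set of equilibrium points (in the Filippov sense) is $\mathcal{X}_F=\{x\in\mathbb{R}^{n_x} : A(\lambda)x+b(\lambda)=0 \text{ for some }\lambda\in\Lambda\}$; a vector $\lambda\in\Lambda$ is said to be associated with $x^*\in\mathcal{X}_F$ if $A(\lambda)x^*+b(\lambda)=0$. For $x\in\mathbb{R}^{n_x}$, $M(x)\in\mathbb{R}^{n_x\times N}$ is the matrix whose $i$-th column is $A_ix+b_i$, so that $M(x)\lambda=A(\lambda)x+b(\lambda)$ for $\lambda\in\Lambda$.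
   Formalization: The usual dimension of the polytope is rank(L) − 1, not rank(L) (e.g. A_i = 0, b_i = 0, N = p = 2, columns e_1, e_2 give a segment with rank(L) = 2); it is proved that the linear hull has dimension rank(L) and the affine hull has dimension rank(L) − 1. *)

(* Defs.v *)
From HB Require Import structures.
From mathcomp Require Import all_boot all_order all_algebra.
From mathcomp Require Import all_classical all_reals all_analysis.

Set Implicit Arguments.
Unset Strict Implicit.
Unset Printing Implicit Defensive.

Import Order.TTheory GRing.Theory Num.Theory.
Import numFieldNormedType.Exports.

Local Open Scope classical_set_scope.
Local Open Scope ring_scope.

Section Sets.
Variables (R : realType).

Definition nonneg_vec (n : nat) (v : 'cV[R]_n) : Prop :=
  forall i, 0 <= v i 0.

Definition unit_simplex (N : nat) : set 'cV[R]_N :=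
  [set lam : 'cV[R]_N | \sum_(i < N) lam i 0 = 1 /\ nonneg_vec lam].

Definition Theta (p : nat) : set 'cV[R]_p :=
  [set theta : 'cV[R]_p | \sum_(j < p) theta j 0 = 1].

Definition polyhedron (n : nat) (S : set 'cV[R]_n) : Prop :=
  exists (m : nat) (C : 'M[R]_(m, n)) (c : 'cV[R]_m),
    S = [set x : 'cV[R]_n | forall i, (C *m x) i 0 <= c i 0].

(* A polytope is a bounded polyhedron; [bounded_set] refers to the sup norm. *)
Definition polytope (n : nat) (S : set 'cV[R]_n) : Prop :=
  polyhedron S /\ bounded_set S.

Definition linear_hull (n : nat) (S : set 'cV[R]_n) : set 'cV[R]_n :=
  [set x : 'cV[R]_n | exists (k : nat) (V : 'M[R]_(n, k)) (c : 'cV[R]_k),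
     (forall j, S (col j V)) /\ x = V *m c].

Definition affine_hull (n : nat) (S : set 'cV[R]_n) : set 'cV[R]_n :=
  [set x : 'cV[R]_n | exists (k : nat) (V : 'M[R]_(n, k)) (theta : 'cV[R]_k),
     [/\ (forall j, S (col j V)), Theta theta & x = V *m theta]].

(* Two dimensions of a set are kept apart: that of its linear hull and that of
   its affine hull. For a nonempty set inside a hyperplane avoiding the origin,
   such as a subset of the unit simplex, the former is one more than the latter. *)
Definition has_linear_dim (n : nat) (S : set 'cV[R]_n) (d : nat) : Prop :=
  exists U : {vspace 'cV[R]_n}, linear_hull S = [set` U] /\ (\dim U)%VS = d.

(* No [d] satisfies this for empty [S]. *)
Definition has_affine_dim (n : nat) (S : set 'cV[R]_n) (d : nat) : Prop :=
  exists (x0 : 'cV[R]_n) (U : {vspace 'cV[R]_n}),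
    affine_hull S = [set x0 + u | u in [set` U]] /\ (\dim U)%VS = d.

End Sets.

Section SwitchedAffine.
Variables (R : realType) (N nx : nat).
Variables (A : 'I_N -> 'M[R]_nx) (b : 'I_N -> 'cV[R]_nx).

Definition Acomb (lam : 'cV[R]_N) : 'M[R]_nx := \sum_(i < N) lam i 0 *: A i.

Definition bcomb (lam : 'cV[R]_N) : 'cV[R]_nx := \sum_(i < N) lam i 0 *: b i.

Definition associated (x : 'cV[R]_nx) (lam : 'cV[R]_N) : Prop :=
  unit_simplex lam /\ Acomb lam *m x + bcomb lam = 0.

Definition X_F : set 'cV[R]_nx :=
  [set x : 'cV[R]_nx | exists lam : 'cV[R]_N, associated x lam].

Definition Mmat (x : 'cV[R]_nx) : 'M[R]_(nx, N) :=
  \matrix_(k < nx, i < N) (A i *m x + b i) k 0.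

End SwitchedAffine.

Definition col_matrix (R : realType) (N p : nat) (lam : 'I_p -> 'cV[R]_N) :
  'M[R]_(N, p) := \matrix_(i < N, j < p) lam j i 0.

Definition PP (R : realType) (N p : nat) (L : 'M[R]_(N, p)) : set 'cV[R]_N :=
  [set lam : 'cV[R]_N | exists theta : 'cV[R]_p,
     [/\ lam = L *m theta, nonneg_vec lam & Theta theta]].

(* Main.v *)
(* Each column of L lies in the unit simplex, so the coordinate sum of L theta is
   that of theta; hence P(x* ) is the intersection of the column space of L with
   the unit simplex. It contains the columns of L, so its linear hull is the
   column space, and its affine hull is the hyperplane section of that space
   where the coordinates sum to 1. *)

Require Import Defs.
From HB Require Import structures.
From mathcomp Require Import all_boot all_order all_algebra.
From mathcomp Require Import all_classical all_reals all_analysis.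

Set Implicit Arguments.
Unset Strict Implicit.
Unset Printing Implicit Defensive.

Import Order.TTheory GRing.Theory Num.Theory.
Import numFieldNormedType.Exports.

Local Open Scope classical_set_scope.
Local Open Scope ring_scope.

(** As a matrix product, the coordinate sum can be carried through [L *m t] by associativity,
    without exchanging sums. *)
Lemma sum_cV (R : realType) (n : nat) (x : 'cV[R]_n) :
  \sum_(i < n) x i 0 = ((const_mx 1 : 'rV_n) *m x) 0 0.
Proof. by rewrite mxE; apply: eq_bigr => i _; rewrite !mxE mul1r. Qed.

Section Polyhedra.
Variables (R : realType) (n : nat).

Lemma polyhedronI (S T : set 'cV[R]_n) :
  polyhedron S -> polyhedron T -> polyhedron (S `&` T).
Proof.
move=> [m [C [c ->]]] [k [D [d ->]]].
exists (m + k)%N, (col_mx C D), (col_mx c d).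
apply/seteqP; split=> x /=.
  move=> [hC hD] i; rewrite mul_col_mx; case: (fintype.split_ordP i) => j ->.
    by rewrite !col_mxEu.
  by rewrite !col_mxEd.
move=> h; split=> i.
  by have := h (lshift k i); rewrite mul_col_mx !col_mxEu.
by have := h (rshift m i); rewrite mul_col_mx !col_mxEd.
Qed.

Lemma polyhedron_eq (m : nat) (C : 'M[R]_(m, n)) (c : 'cV[R]_m) :
  polyhedron [set x | C *m x = c].
Proof.
have -> : [set x | C *m x = c] =
    [set x | forall i, (C *m x) i 0 <= c i 0] `&`
    [set x | forall i, ((- C) *m x) i 0 <= (- c) i 0].
  apply/seteqP; split=> x /=.
    by move=> <-; split=> i; rewrite ?mulNmx.
  move=> [h1 h2]; apply/colP => i; apply/eqP; rewrite eq_le h1 /=.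
  by have := h2 i; rewrite mulNmx !mxE lerN2.
by apply: polyhedronI; [exists m, C, c | exists m, (- C), (- c)].
Qed.

Lemma polyhedron_nonneg : polyhedron [set x : 'cV[R]_n | nonneg_vec x].
Proof.
exists n, (- 1%:M), 0; apply/seteqP; split=> x /= h i.
  by rewrite mulNmx mul1mx !mxE oppr_le0.
by have := h i; rewrite mulNmx mul1mx !mxE oppr_le0.
Qed.

Lemma polyhedron_unit_simplex : polyhedron (@unit_simplex R n).
Proof.
have -> : @unit_simplex R n =
    [set x | (const_mx 1 : 'rV_n) *m x = 1%:M] `&` [set x | nonneg_vec x].
  apply/seteqP; split=> x [/= h0 h]; split=> //=.
    by apply/rowP => i; rewrite !ord1 -sum_cV h0 mxE.
  by rewrite sum_cV h0 mxE.
exact: polyhedronI (polyhedron_eq _ _) polyhedron_nonneg.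
Qed.

(** The column space is the solution set of a homogeneous linear system. The transposes appear
    because [cokermx] and [submxE] speak of row spaces: [x] is a combination of columns of [L] iff
    [x^T] lies in the row space of [L^T]. *)
Lemma polyhedron_colspace (k : nat) (L : 'M[R]_(n, k)) :
  polyhedron [set L *m t | t in [set: 'cV[R]_k]].
Proof.
have -> : [set L *m t | t in [set: 'cV[R]_k]] =
    [set x | (cokermx L^T)^T *m x = 0].
  apply/seteqP; split=> x /=.
    move=> [t _ <-]; apply: trmx_inj.
    by rewrite trmx_mul trmxK trmx0 trmx_mul -mulmxA mulmx_coker mulmx0.
  move=> /(congr1 trmx); rewrite trmx_mul trmxK trmx0 => /eqP.
  rewrite -submxE => /submxP[D /(congr1 trmx)]; rewrite trmxK trmx_mul trmxK => ->.
  by exists D^T.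
exact: polyhedron_eq.
Qed.

(** Nonnegative coordinates with sum 1 are each at most 1, so every [M > 1] bounds the sup norm. *)
Lemma unit_simplex_bounded : bounded_set (@unit_simplex R n).
Proof.
exists 1; split=> // M M1 x [x1 x0]; rewrite /Num.norm /= mx_normrE.
apply: (le_trans _ (ltW M1)); apply: bigmax_le => // -[i j] _ /=.
rewrite ord1 ger0_norm ?x0 // -x1 (bigD1 i) //= lerDl.
by apply: sumr_ge0 => k _; exact: x0.
Qed.

(** Links the matrix rank to the dimension of a [vspace]: the columns of [col_base L] form a basis
    of the column space. *)
Lemma colspace_vspace (k : nat) (L : 'M[R]_(n, k)) :
  exists2 U : {vspace 'cV[R]_n},
    [set` U] = [set L *m t | t in [set: 'cV[R]_k]] & \dim U = \rank L.
Proof.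
pose B := col_base L.
pose X := [tuple col j B | j < \rank L].
have XE (c : 'I_(\rank L) -> R) : \sum_j c j *: X`_j = B *m \col_j c j.
  apply/colP => i; rewrite summxE mxE; apply: eq_bigr => j _.
  by rewrite -tnth_nth tnth_mktuple !mxE mulrC.
(* [B] has full column rank, so [pinvmx B] is a left inverse. *)
have freeX : free X.
  apply/freeP => c; rewrite XE => /(congr1 (mulmx (pinvmx B))).
  rewrite mulmxA mulVpmx ?col_base_full // mul1mx mulmx0 => /colP h i.
  by have := h i; rewrite !mxE.
exists <<X>>%VS; last by rewrite (eqP freeX) size_tuple.
apply/seteqP; split=> x /=.
  move=> xX; have -> : x = B *m \col_j coord X j x.
    by rewrite -XE; exact: coord_span.
  (* Since [L = B *m row_base L] and [row_base L] has full row rank, its right inverse lifts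
     coordinates in the basis [X] to coefficients on the columns of [L]. *)
  exists (pinvmx (row_base L) *m \col_j coord X j x) => //.
  by rewrite -{1}(mulmx_base L) -mulmxA (mulmxA (row_base L)) mulmxVp ?row_base_free // mul1mx.
move=> [t _ <-]; pose c := row_base L *m t.
have -> : L *m t = B *m \col_j c j 0.
  rewrite -{1}(mulmx_base L) -mulmxA; congr (_ *m _).
  by apply/colP => j; rewrite [RHS]mxE.
rewrite -XE; apply: rpred_sum => j _; apply: rpredZ.
by apply: memv_span; rewrite mem_nth // size_tuple.
Qed.

End Polyhedra.

Section PPTheory.
Variables (R : realType) (N p : nat) (L : 'M[R]_(N, p)).
Hypothesis Lsimplex : forall j, unit_simplex (col j L).

Lemma sum_mulmx_stochastic (t : 'cV[R]_p) :
  \sum_(i < N) (L *m t) i 0 = \sum_(j < p) t j 0.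
Proof.
rewrite !sum_cV mulmxA; congr ((_ *m t) 0 0); apply/rowP => j.
have [+ _] := Lsimplex j; rewrite sum_cV => h.
by rewrite [RHS]mxE -[RHS]h !mxE; apply: eq_bigr => i _; rewrite !mxE.
Qed.

Lemma PP_colspace_simplex :
  PP L = [set L *m t | t in [set: 'cV[R]_p]] `&` @unit_simplex R N.
Proof.
apply/seteqP; split=> x /=.
  move=> [t [-> x0 t1]]; split; first by exists t.
  by split=> //; rewrite sum_mulmx_stochastic.
move=> [[t _ <-] [h1 h0]]; exists t; split=> //.
by rewrite /Theta /= -sum_mulmx_stochastic.
Qed.

Lemma PP_col j : PP L (col j L).
Proof.
by rewrite PP_colspace_simplex; split=> //; exists (delta_mx j 0); rewrite // colE.
Qed.

Lemma polytope_PP : polytope (PP L).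
Proof.
rewrite PP_colspace_simplex; split.
  exact: polyhedronI (polyhedron_colspace L) (@polyhedron_unit_simplex R N).
by apply: sub_boundedr (@unit_simplex_bounded R N) => P SP x [_ /SP].
Qed.

(** Each column of [V] is [L] times a vector of sum 1. Collecting these vectors in [T] gives
    [V = L *m T], and [T] preserves coordinate sums. The first fact serves the linear hull, both
    together the affine hull. *)
Lemma PP_combination (k : nat) (V : 'M[R]_(N, k)) (c : 'cV[R]_k) :
  (forall j, PP L (col j V)) ->
  exists2 t : 'cV[R]_p, V *m c = L *m t & \sum_j t j 0 = \sum_j c j 0.
Proof.
move=> VP.
have /fin_all_exists[f hf] j : exists t : 'cV[R]_p, col j V = L *m t /\ Theta t.
  by have [t [? _ ?]] := VP j; exists t.
pose T := \matrix_(i, j) f j i 0.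
exists (T *m c).
  rewrite mulmxA; congr (_ *m _); apply/matrixP => i j.
  have [/colP/(_ i) + _] := hf j; rewrite !mxE => ->.
  by apply: eq_bigr => l _; rewrite mxE.
rewrite !sum_cV mulmxA; congr ((_ *m c) 0 0); apply/rowP => j.
have [_ h] := hf j; rewrite [RHS]mxE -[RHS]h !mxE.
by apply: eq_bigr => i _; rewrite !mxE mul1r.
Qed.

Lemma linear_hull_PP :
  linear_hull (PP L) = [set L *m t | t in [set: 'cV[R]_p]].
Proof.
apply/seteqP; split=> x /=.
  by move=> [k [V [c [/(PP_combination c)[t -> _] ->]]]]; exists t.
by move=> [t _ <-]; exists p, L, t; split=> //; exact: PP_col.
Qed.

Lemma affine_hull_PP : affine_hull (PP L) = [set L *m t | t in @Theta R p].
Proof.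
apply/seteqP; split=> x /=.
  move=> [k [V [c [/(PP_combination c)[t -> tc] c1 ->]]]].
  by exists t => //; rewrite /Theta /= tc.
by move=> [t t1 <-]; exists p, L, t; split=> //; exact: PP_col.
Qed.

Lemma has_linear_dim_PP : has_linear_dim (PP L) (\rank L).
Proof.
have [U UE dU] := colspace_vspace L.
by exists U; rewrite linear_hull_PP UE.
Qed.

(* The direction space of the affine hull is the kernel, inside the column
   space, of the coordinate sum, a functional equal to 1 on every column. *)
Lemma has_affine_dim_PP (j0 : 'I_p) : has_affine_dim (PP L) (\rank L).-1.
Proof.
have [U UE dU] := colspace_vspace L.
have UP (x : 'cV_N) : x \in U <-> exists t : 'cV[R]_p, L *m t = x.
  have -> : (x \in U) = [set` U] x :> Prop by [].
  by rewrite UE; split=> [[t _]|[t]]; exists t.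
pose s : 'Hom('cV[R]_N, 'cV[R]_1) := linfun (mulmx (const_mx 1)).
have sE (x : 'cV_N) : (s x == 0) = (\sum_i x i 0 == 0).
  rewrite lfunE /= sum_cV; apply/eqP/eqP => [->|h]; first by rewrite mxE.
  by apply/rowP => i; rewrite ord1 h mxE.
exists (col j0 L), (U :&: lker s)%VS; split; last first.
  (* The target of [s] has dimension 1, and the image is nonzero because column [j0] has coordinate
     sum 1. *)
  have : (\dim (s @: U) = 1)%N.
    apply/eqP; rewrite eqn_leq; apply/andP; split.
      by apply: leq_trans (dimvS (subvf _)) _; rewrite dimvf dim_matrix.
    rewrite lt0n dimv_eq0; apply/negP => /eqP h.
    have : s (col j0 L) \in (s @: U)%VS.
      by apply: memv_img; apply/UP; exists (delta_mx j0 0); rewrite colE.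
    by rewrite h memv0 sE (Lsimplex j0).1 oner_eq0.
  (* Rank-nullity on [U]: the kernel part has dimension one less than [\rank L]. *)
  by have := limg_ker_dim s U; rewrite dU => <- ->; rewrite addn1.
rewrite affine_hull_PP; apply/seteqP; split=> x /=.
  move=> [t t1 <-]; exists (L *m t - col j0 L); last by rewrite addrC subrK.
  rewrite /= memv_cap memv_ker sE; apply/andP; split.
    by apply/UP; exists (t - delta_mx j0 0); rewrite mulmxBr -colE.
  under eq_bigr do rewrite mxE [X in _ + X]mxE.
  by rewrite sumrB sum_mulmx_stochastic t1 (Lsimplex j0).1 subrr.
move=> [u]; rewrite /= memv_cap memv_ker sE => /andP[/UP[t <-]].
rewrite sum_mulmx_stochastic => /eqP t0 <-.
exists (delta_mx j0 0 + t); last by rewrite mulmxDr -colE.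
rewrite /Theta /= -sum_mulmx_stochastic mulmxDr -colE.
under eq_bigr do rewrite mxE.
by rewrite big_split /= sum_mulmx_stochastic t0 addr0 (Lsimplex j0).1.
Qed.

End PPTheory.

(** Makes association with [x] a linear equation in [lam], which passes from the columns of [L] to
    every [L *m t]. *)
Lemma Mmat_mul (R : realType) (N nx : nat) (A : 'I_N -> 'M[R]_nx)
    (b : 'I_N -> 'cV[R]_nx) (x : 'cV[R]_nx) (lam : 'cV[R]_N) :
  Mmat A b x *m lam = Acomb A lam *m x + bcomb b lam.
Proof.
rewrite /Acomb /bcomb mulmx_suml -big_split /=; apply/colP => k.
rewrite mxE summxE; apply: eq_bigr => i _.
by rewrite -scalemxAl -scalerDr [in LHS]mxE [in RHS]mxE mulrC.
Qed.

Theorem theorem2 (R : realType) (N nx : nat) (hN : (0 < N)%N) (hnx : (0 < nx)%N)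
    (A : 'I_N -> 'M[R]_nx) (b : 'I_N -> 'cV[R]_nx)
    (xs : 'cV[R]_nx) (hxs : X_F A b xs)
    (p : nat) (hp : (1 < p)%N) (lam : 'I_p -> 'cV[R]_N)
    (hdistinct : injective lam)
    (hsol : forall j : 'I_p,
       [/\ Mmat A b xs *m lam j = 0, nonneg_vec (lam j)
         & \sum_(i < N) lam j i 0 = 1]) :
  let L := col_matrix lam in
  [/\ polytope (PP L),
      has_linear_dim (PP L) (\rank L) /\ has_affine_dim (PP L) (\rank L).-1,
      PP L `<=` @unit_simplex R N
    & forall lams : 'cV[R]_N, PP L lams -> associated A b xs lams].
Proof.
move=> L.
have colL j : col j L = lam j by apply/colP => i; rewrite !mxE.
have Lsimplex j : unit_simplex (col j L).
  by rewrite colL; have [_ ? ?] := hsol j.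
have ML : Mmat A b xs *m L = 0.
  apply/matrixP => k j; have [/colP/(_ k) h _ _] := hsol j.
  rewrite mxE [RHS]mxE in h; rewrite mxE [RHS]mxE -[RHS]h.
  by apply: eq_bigr => i _; rewrite [L i j]mxE.
have PPs : PP L `<=` @unit_simplex R N.
  by rewrite (PP_colspace_simplex Lsimplex); exact: subIsetr.
split=> //.
- exact: polytope_PP.
- split; first exact: has_linear_dim_PP.
  (* Index 0, available since [1 < p], supplies the base point of the affine hull. *)
  exact: has_affine_dim_PP Lsimplex (Ordinal (ltnW hp)).
- move=> x Px; split; first exact: PPs.
  have [t [-> _ _]] := Px.
  by rewrite -Mmat_mul mulmxA ML mul0mx.
Qed.
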